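(* Let $G=(V,E)$ be a finite undirected graph which is a tree, a cycle, or a clique, and let $t:V\to\mathbb{N}$ be any threshold function. Then every execution of the algorithm MTS on input $(G,t)$ (for any tie-breaking) returns a minimum-size target set for $G$ with thresholds $t$.
   Context: Graphs are finite, without loops. An undirected graph is treated as the bidirected digraph in which each edge $\{u,v\}$ is replaced by the two arcs $(u,v),(v,u)$. For a digraph $G=(V,E)$ and $v\in V$, $\Gamma^{in}(v)=\{u:(u,v)\in E\}$ and $\Gamma^{out}(v)=\{u:(v,u)\in E\}$. Given thresholds $t:V\to\mathbb{N}=\{0,1,2,\dots\}$ and $S\subseteq V$, the activation process starting at $S$ is $A_0=S$ and $A_\ell=A_{\ell-1}\cup\{u\in V: |\Gamma^{in}(u)\cap A_{\ell-1}|\ge t(u)\}$ for $\ell\ge1$. $S$ is a target set for $(G,t)$ if $A_\lambda=V$ for some $\lambda\ge0$. Algorithm MTS on input $(G,t)$: set $S=\emptyset$, $L=\emptyset$, $U=V$, and for each $v\in V$ set $k(v)=t(v)$, $\delta(v)=|\Gamma^{in}(v)|$. While $U\neq\emptyset$, perform one iteration as follows. Case 1: if some $v\in U$ has $k(v)=0$, select such a $v$; for each $u\in\Gamma^{out}(v)\cap U$ set $k(u)=\max(k(u)-1,0)$ and, if $v\notin L$, set $\delta(u)=\delta(u)-1$; then set $U=U\setminus\{v\}$. Case 2: otherwise, if some $v\in U\setminus L$ has $\delta(v)<k(v)$, select such a $v$; set $S=S\cup\{v\}$; for each $u\in\Gamma^{out}(v)\cap U$ set $k(u)=k(u)-1$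 and $\delta(u)=\delta(u)-1$; then set $U=U\setminus\{v\}$. Case 3: otherwise, select $v\in U\setminus L$ maximizing $\frac{k(u)}{\delta(u)(\delta(u)+1)}$ over $u\in U\setminus L$; for each $u\in\Gamma^{out}(v)\cap U$ set $\delta(u)=\delta(u)-1$; set $L=L\cup\{v\}$. When $U=\emptyset$, return $S$. Whenever several nodes qualify in a case, one of them is chosen arbitrarily. *)

(* Defs.v *)
From mathcomp Require Import all_boot all_order all_algebra.

Set Implicit Arguments.
Unset Strict Implicit.
Unset Printing Implicit Defensive.

(* A digraph on the vertex set T is given by its arc relation e; an undirected
   simple graph is the case where e is symmetric and irreflexive. *)

Definition Gin (T : finType) (e : rel T) (v : T) : {set T} := [set u | e u v].

Definition Gout (T : finType) (e : rel T) (v : T) : {set T} := [set u | e v u].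

Fixpoint active (T : finType) (e : rel T) (t : T -> nat) (S : {set T})
    (l : nat) : {set T} :=
  if l is l'.+1 then
    active e t S l' :|: [set u | t u <= #|Gin e u :&: active e t S l'|]
  else S.

Definition target_set (T : finType) (e : rel T) (t : T -> nat)
    (S : {set T}) : Prop :=
  exists l : nat, active e t S l = [set: T].

Definition min_target_set (T : finType) (e : rel T) (t : T -> nat)
    (S : {set T}) : Prop :=
  target_set e t S /\ forall S' : {set T}, target_set e t S' -> #|S| <= #|S'|.

Record mts_state (T : finType) := MtsState {
  stS : {set T};
  stL : {set T};
  stU : {set T};
  stk : T -> nat;
  std : T -> nat (* delta *)
}.

Definition mts_init (T : finType) (e : rel T) (t : T -> nat) : mts_state T :=
  MtsState set0 set0 [set: T] t (fun v => #|Gin e v|).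

Definition mts_case1 (T : finType) (s : mts_state T) (v : T) : bool :=
  (v \in stU s) && (stk s v == 0).

Definition mts_case2 (T : finType) (s : mts_state T) (v : T) : bool :=
  (v \in stU s :\: stL s) && (std s v < stk s v).

(* The denominator vanishes only if std s u = 0; this never happens for the
   u in U :\: L when the third case applies, as then 0 < stk s u <= std s u. *)
Definition mts_ratio (T : finType) (s : mts_state T) (u : T) : rat :=
  ((stk s u)%:R / ((std s u)%:R * ((std s u)%:R + 1)))%R.

(* Decrements are truncated at 0 by .-1. In the first case this is the maximum
   with 0 of the algorithm. It has no other effect: stk is positive on U
   outside the first case, and along an execution std s u is, for u in U, the
   number of in-neighbours of u in U :\: L, so it is positive whenever it is
   decremented. *)
Inductive mts_step (T : finType) (e : rel T) (s : mts_state T) :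
    mts_state T -> Prop :=
| MtsStep1 (v : T) of mts_case1 s v :
    mts_step e s (MtsState (stS s) (stL s) (stU s :\ v)
      (fun u => if u \in Gout e v :&: stU s then (stk s u).-1 else stk s u)
      (fun u => if (u \in Gout e v :&: stU s) && (v \notin stL s)
                then (std s u).-1 else std s u))
| MtsStep2 (v : T) of (forall u, ~~ mts_case1 s u) & mts_case2 s v :
    mts_step e s (MtsState (v |: stS s) (stL s) (stU s :\ v)
      (fun u => if u \in Gout e v :&: stU s then (stk s u).-1 else stk s u)
      (fun u => if u \in Gout e v :&: stU s then (std s u).-1 else std s u))
| MtsStep3 (v : T) of (forall u, ~~ mts_case1 s u)
    & (forall u, ~~ mts_case2 s u)
    & v \in stU s :\: stL s
    & (forall u, u \in stU s :\: stL s -> (mts_ratio s u <= mts_ratio s v)%R) :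
    mts_step e s (MtsState (stS s) (v |: stL s) (stU s)
      (stk s)
      (fun u => if u \in Gout e v :&: stU s then (std s u).-1 else std s u)).

Inductive mts_reachable (T : finType) (e : rel T) (t : T -> nat) :
    mts_state T -> Prop :=
| MtsReachInit : mts_reachable e t (mts_init e t)
| MtsReachStep (s s' : mts_state T) of
    mts_reachable e t s & mts_step e s s' : mts_reachable e t s'.

(* Every execution returns a set satisfying P: no execution runs forever, none
   gets stuck while U is nonempty, and the S of each final state satisfies P. *)
Definition mts_always_returns (T : finType) (e : rel T) (t : T -> nat)
    (P : {set T} -> Prop) : Prop :=
  [/\ forall f : nat -> mts_state T,
        f 0 = mts_init e t -> ~ (forall i, mts_step e (f i) (f i.+1)),
      forall s, mts_reachable e t s -> stU s != set0 ->
        exists s', mts_step e s s'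
    & forall s, mts_reachable e t s -> stU s = set0 -> P (stS s)].

(* The bound on size discards the closed walks [:: x; y] along a single edge,
   which ucycle accepts. *)
Definition is_tree (T : finType) (e : rel T) : Prop :=
  [/\ 0 < #|T|,
      forall x y : T, connect e x y
    & forall c : seq T, ucycle e c -> size c < 3].

Definition is_cycle (T : finType) (e : rel T) : Prop :=
  exists c : seq T,
    [/\ 3 <= size c, uniq c, forall x : T, x \in c
      & forall x y : T, e x y = (y == next c x) || (x == next c y)].

Definition is_clique (T : finType) (e : rel T) : Prop :=
  forall x y : T, x != y -> e x y.

(* Main.v *)
Require Import Defs.
From mathcomp Require Import all_boot all_order all_algebra.
From mathcomp Require Import zify.

(* A set of vertices X is blocking if every x in X has fewer than t(x)
   neighbours outside X; target sets are exactly the sets meeting every blocking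
   set. Minimality is shown by weighing any other target set S' against blocking
   sets read off the run of the algorithm.

   On a forest, case 3 always picks a leaf of G[U \ L] with k = delta = 1, so
   every limbo vertex hangs from a single root in U \ L. When case 2 selects v,
   the vertices hanging from v form a blocking set, and these sets are pairwise
   disjoint. A cycle becomes a forest once a vertex is removed. If instead its
   first step puts some v0 in limbo, then all thresholds are 1 or 2, and counting
   boundary edges gives 2|S| <= sum_{x <> v0} (t(x) - 1) + 2, while every target
   set S' has 2|S'| >= sum_x (t(x) - 1). On a clique, at a case 2 selection of v
   all of S, v and L have threshold at least n - |L|, so any |L| + 1 of them
   block. *)

Set Implicit Arguments.
Unset Strict Implicit.
Unset Printing Implicit Defensive.

Lemma cardsDD1 (T : finType) (A U : {set T}) (v : T) :
  v \in U -> #|A :\: (U :\ v)| = #|A :\: U| + (v \in A).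
Proof.
move=> vU; rewrite (cardsD1 v) !inE eqxx /= addnC; congr (_ + _).
apply: eq_card => x; rewrite !inE.
by case: (eqVneq x v) => [->|_] /=; rewrite ?vU ?andbF.
Qed.

(** * Blocking sets and their duality with target sets *)

Section BlockingSets.

Variables (T : finType) (e : rel T) (t : T -> nat).

(** Neighbours in [Z] are ignored, as if they never became active. [Z = set0] gives the ordinary
    notion; [Z = [set v0]] serves cycles whose first step puts [v0] in limbo. *)
Definition blocking (Z X : {set T}) : Prop :=
  X != set0 /\ forall x, x \in X -> #|Gin e x :\: (Z :|: X)| < t x.

Lemma not_blocking (Y : {set T}) : Y != set0 -> ~ blocking set0 Y ->
  exists2 y, y \in Y & t y <= #|Gin e y :\: Y|.
Proof.
move=> Y0 nb.
case: (boolP [exists y in Y, t y <= #|Gin e y :\: Y|]) => [/exists_inP //|].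
rewrite negb_exists_in => /forall_inP H; case: nb; split=> // x xY.
by rewrite set0U ltnNge H.
Qed.

Lemma subset_active (S : {set T}) l : S \subset active e t S l.
Proof. by elim: l => //= l IH; apply: subset_trans IH (subsetUl _ _). Qed.

(** A process started outside [Y] never enters it: as long as all active vertices lie outside [Y],
    no vertex of [Y] has enough active neighbours. *)
Lemma target_set_hits (S Y : {set T}) :
  target_set e t S -> blocking set0 Y -> S :&: Y != set0.
Proof.
move=> [l Hl] [Y0 HY]; apply/negP => /eqP SY0.
have: [disjoint active e t S l & Y].
  elim: l {Hl} => [|l IH] /=; first by rewrite -setI_eq0 SY0.
  rewrite -setI_eq0 setIUl setU_eq0 !setI_eq0 IH disjoint_subset /=.
  apply/subsetP => u; rewrite !inE => Hu.
  apply/negP => /HY; rewrite set0U ltnNge => /negP; apply.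
  apply: leq_trans Hu _; apply/subset_leq_card/subsetP => x.
  rewrite !in_setI in_setD => /andP[-> xA].
  by rewrite (disjointFr IH xA).
by rewrite Hl -setI_eq0 setTI (negPf Y0).
Qed.

(** While some vertex is inactive, the inactive set misses [S], so it is not blocking and one of its
    vertices is activated next. Such growth cannot last [#|T|.+1] rounds. *)
Lemma hits_target_set (S : {set T}) :
  (forall Y, blocking set0 Y -> S :&: Y != set0) -> target_set e t S.
Proof.
move=> H.
have grow l : active e t S l = [set: T] \/ l <= #|active e t S l|.
  elim: l => [|l [E|IH]] /=; [by right | by left; rewrite E setTU |].
  case: (eqVneq (active e t S l) [set: T]) => [->|nT]; first by left; rewrite setTU.
  right; apply: leq_ltn_trans IH _; apply: proper_card.
  rewrite properE subsetUl /=; apply/negP => sub.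
  have Y0 : ~: active e t S l != set0 by rewrite -setCT (inj_eq (@setC_inj T)).
  have /(not_blocking Y0)[y yY] : ~ blocking set0 (~: active e t S l).
    move=> /H /set0Pn[x /setIP[xS]]; rewrite inE.
    by rewrite (subsetP (subset_active S l) _ xS).
  rewrite setDE setCK => ty; move: yY; rewrite inE => /negP; apply.
  by apply: (subsetP sub); rewrite !inE ty orbT.
exists #|T|.+1; case: (grow #|T|.+1) => // bad.
by have := leq_trans bad (max_card _); rewrite ltnn.
Qed.

End BlockingSets.

(** * Termination of the algorithm *)

Definition mts_measure (T : finType) (s : mts_state T) := #|stU s| + #|~: stL s|.

Lemma mts_step_measure (T : finType) (e : rel T) (s s' : mts_state T) :
  mts_step e s s' -> mts_measure s' < mts_measure s.
Proof.
rewrite /mts_measure; case=> [v /andP[vU _]|v _ /andP[/setDP[vU _] _]|v _ _ /setDP[_ vL] _] /=.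
- by rewrite ltn_add2r [X in _ < X](cardsD1 v) vU.
- by rewrite ltn_add2r [X in _ < X](cardsD1 v) vU.
- rewrite ltn_add2l [X in _ < X](cardsD1 v) inE vL ltnS.
  by apply/subset_leq_card/subsetP => x; rewrite !inE negb_or.
Qed.

Lemma mts_terminates (T : finType) (e : rel T) (f : nat -> mts_state T) :
  ~ (forall i, mts_step e (f i) (f i.+1)).
Proof.
move=> H.
have G i : mts_measure (f i) + i <= mts_measure (f 0).
  elim: i => [|i IH]; first by rewrite addn0.
  by have := mts_step_measure (H i); lia.
by have := G (mts_measure (f 0)).+1; lia.
Qed.

Lemma mts_ratio_le (T : finType) (s : mts_state T) (u v : T) :
  0 < std s u -> 0 < std s v -> (mts_ratio s u <= mts_ratio s v)%R ->
  stk s u * (std s v * (std s v).+1) <= stk s v * (std s u * (std s u).+1).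
Proof.
move=> du dv; rewrite /mts_ratio !GRing.natr1 -!GRing.natrM.
rewrite Num.Theory.ler_pdivrMr ?Num.Theory.ltr0n ?muln_gt0 ?du //.
rewrite GRing.mulrAC Num.Theory.ler_pdivlMr ?Num.Theory.ltr0n ?muln_gt0 ?dv //.
by rewrite -!GRing.natrM Num.Theory.ler_nat.
Qed.

(** * Invariants of an execution, progress, and correctness of the result *)

Section Invariant.

Variables (T : finType) (e : rel T) (t : T -> nat).
Hypothesis e_irr : irreflexive e.

(** [inv_L] yields progress: limbo alone never blocks. [inv_S] yields correctness: once [U] is
    empty, [S] cannot miss a blocking set, since these are nonempty. *)
Record mts_inv (s : mts_state T) : Prop := MtsInv {
  inv_k : forall u, u \in stU s -> stk s u = t u - #|Gin e u :\: stU s|;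
  inv_d : forall u, u \in stU s -> std s u = #|Gin e u :&: (stU s :\: stL s)|;
  inv_SU : forall u, u \in stS s -> u \notin stU s;
  inv_L : forall Y : {set T}, Y \subset stL s :&: stU s -> ~ blocking e t set0 Y;
  inv_S : forall Y : {set T}, blocking e t set0 Y -> stS s :&: Y = set0 ->
            Y \subset stU s }.

Lemma mts_inv_init : mts_inv (mts_init e t).
Proof.
split=> //=.
- by move=> u _; rewrite setDT cards0 subn0.
- by move=> u _; rewrite setD0 setIT.
- by move=> u; rewrite inE.
- by move=> Y; rewrite set0I subset0 => /eqP-> []; rewrite eqxx.
Qed.

Lemma mts_inv_step s s' : mts_inv s -> mts_step e s s' -> mts_inv s'.
Proof.
case=> Ik Id ISU IL IS.
have Gio u v : (u \in Gout e v) = (v \in Gin e u) by rewrite !inE.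
have Kdec v u : v \in stU s -> u \in stU s ->
    (if u \in Gout e v :&: stU s then (stk s u).-1 else stk s u)
    = t u - #|Gin e u :\: (stU s :\ v)|.
  move=> vU uU; rewrite cardsDD1 // in_setI uU Gio andbT Ik //.
  by case: (v \in Gin e u); lia.
have Ddec v u (A : {set T}) : v \in A ->
    #|Gin e u :&: (A :\ v)| = #|Gin e u :&: A| - (v \in Gin e u).
  move=> vA; rewrite [in RHS](cardsD1 v) in_setI vA andbT addKn.
  by apply: eq_card => x; rewrite !inE; case: (x != v); rewrite ?andbF.
case=> [v c1|v nc1 c2|v nc1 nc2 vUL vmax]; split=> /=.
- move=> u /setD1P[_ uU]; case/andP: c1 => vU _; exact: Kdec.
- move=> u /setD1P[_ uU]; case/andP: c1 => vU _.
  rewrite in_setI uU Gio andbT Id //.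
  case: (boolP (v \in stL s)) => vL.
    rewrite andbF; apply: eq_card => x; rewrite !inE.
    by case: (eqVneq x v) => [->|//]; rewrite vL !andbF.
  have -> : (stU s :\ v) :\: stL s = (stU s :\: stL s) :\ v.
    by rewrite !setDDl setUC.
  rewrite Ddec ?inE ?vU ?vL // andbT.
  by case: (e v u); lia.
- by move=> u /ISU; rewrite !inE negb_and => ->; rewrite orbT.
- by move=> Y sY; apply: IL; apply: subset_trans sY _; rewrite setIS // subD1set.
(* [k = 0] gives [v] at least [t v] neighbours outside [U], hence outside [Y], so [v] cannot belong
   to [Y]. *)
- move=> Y bY SY; have YU := IS Y bY SY; rewrite subsetD1 YU /=.
  apply/negP => vY; case/andP: c1 => vU /eqP; rewrite Ik // => k0.
  have := bY.2 v vY; rewrite set0U ltnNge => /negP; apply.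
  by apply: leq_trans (subset_leq_card (setDS _ YU)); lia.
- move=> u /setD1P[_ uU]; case/andP: c2 => /setDP[vU _] _; exact: Kdec.
- move=> u /setD1P[_ uU]; case/andP: c2 => vUL _; have /setDP[vU vL] := vUL.
  have -> : (stU s :\ v) :\: stL s = (stU s :\: stL s) :\ v.
    by rewrite !setDDl setUC.
  rewrite Ddec // in_setI uU Gio andbT Id //.
  by case: (v \in Gin e u); lia.
- by move=> u; rewrite !inE negb_and => /orP[->//|/ISU->]; rewrite orbT.
- by move=> Y sY; apply: IL; apply: subset_trans sY _; rewrite setIS // subD1set.
- move=> Y bY; rewrite setIUl => /eqP; rewrite setU_eq0 => /andP[vY /eqP SY].
  rewrite subsetD1 (IS Y bY SY) /=; apply/negP => vY'.
  by move/eqP/setP/(_ v): vY; rewrite !inE eqxx vY'.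
- by move=> u uU; rewrite Ik.
- move=> u uU.
  have -> : stU s :\: (v |: stL s) = (stU s :\: stL s) :\ v.
    by rewrite setDDl setUC.
  rewrite Ddec // in_setI uU Gio andbT Id //.
  by case: (v \in Gin e u); lia.
- by move=> u /ISU.
(* As case 2 fails, [k <= delta] at [v], so at least [t v] neighbours of [v] lie outside [U] or in
   [U :\: L]. All of them are outside [Y], so a [Y] containing [v] does not block. *)
- move=> Y sY bY; case: (boolP (v \in Y)) => vY; last first.
    apply: (IL Y _ bY); apply/subsetP => x xY; move: (subsetP sY _ xY).
    by rewrite !inE; case: (eqVneq x v) vY => [<-|_]; rewrite ?xY.
  have /setDP[vU vL] := vUL; move: (nc2 v); rewrite /mts_case2 vUL /= -leqNgt.
  rewrite Ik // Id // => kd; have := bY.2 v vY; rewrite set0U ltnNge => /negP; apply.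
  apply: leq_trans (_ : #|Gin e v :\: stU s| + #|Gin e v :&: (stU s :\: stL s)| <= _).
    by lia.
  rewrite -cardsUI; set I := (_ :\: _) :&: _; have -> : I = set0.
    by apply/setP => x; rewrite !inE; case: (x \in stU s); rewrite ?andbF.
  rewrite cards0 addn0; apply/subset_leq_card/subsetP => x.
  rewrite !inE => H; apply/andP; split; last by case/orP: H => /andP[].
  apply/negP => /(subsetP sY); rewrite !inE => /andP[]; move: H.
  case: (eqVneq x v) => [->|_ /= H xL xU]; first by rewrite e_irr !andbF.
  by rewrite xL xU /= andbF in H.
- exact: IS.
Qed.

Lemma mts_reachable_inv s : mts_reachable e t s -> mts_inv s.
Proof. by elim=> [|s1 s2 _ IH /(mts_inv_step IH)//]; apply: mts_inv_init. Qed.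

(** If [U] were contained in [L], [inv_L] would give a vertex [y] of [U] with [t y] neighbours
    outside [U], that is, with [k = 0]. So when cases 1 and 2 fail, case 3 has a candidate. *)
Lemma mts_progress s : mts_inv s -> stU s != set0 -> exists s', mts_step e s s'.
Proof.
move=> I U0.
case: (boolP [exists v, mts_case1 s v]) => [/existsP[v c1]|].
  by eexists; apply: MtsStep1 c1.
rewrite negb_exists => /forallP nc1.
case: (boolP [exists v, mts_case2 s v]) => [/existsP[v c2]|].
  by eexists; apply: MtsStep2 nc1 c2.
rewrite negb_exists => /forallP nc2.
have [UL0|/set0Pn[v0 v0UL]] := eqVneq (stU s :\: stL s) set0; last first.
  have [v vUL vmax] := Order.TotalTheory.arg_maxP (mts_ratio s) v0UL.
  by eexists; apply: MtsStep3 nc1 nc2 vUL vmax.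
have UL : stU s \subset stL s by rewrite -setD_eq0 UL0.
have [|y yU ty] := @not_blocking _ e t (stU s) U0.
  by apply: (inv_L I); rewrite subsetI UL subxx.
by move: (nc1 y); rewrite /mts_case1 yU inv_k // -lt0n subn_gt0 ltnNge ty.
Qed.

Lemma mts_target s : mts_inv s -> stU s = set0 -> target_set e t (stS s).
Proof.
move=> I U0; apply: hits_target_set => Y bY; apply/negP => /eqP SY.
by have := inv_S I bY SY; rewrite U0 subset0; apply/negP; case: bY.
Qed.

End Invariant.

(** * Charging each selection to the vertices hanging from it *)

Lemma sum_subset (T : finType) (w : T -> nat) (A B : {set T}) :
  A \subset B -> \sum_(x in A) w x <= \sum_(x in B) w x.
Proof.
by move=> /setIidPr AB; rewrite [X in _ <= X](big_setID A) /= AB leq_addr.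
Qed.

Section Rooted.

Variables (T : finType) (e : rel T) (t : T -> nat).
Hypotheses (e_sym : symmetric e) (e_irr : irreflexive e).
Variables (Z : {set T}) (w : T -> nat) (c : nat).

(* [rho] sends a vertex of limbo to the vertex of [U :\: L] on which its
   activation depends; the vertices of [Z] are ignored. *)
Definition rooted (s : mts_state T) (rho : T -> T) : Prop :=
  (forall x, x \in stU s :\: stL s -> rho x = x) /\
  (forall x y, x \in (stL s :&: stU s) :\: Z -> y \in stU s :\: Z -> e x y ->
     rho x = rho y).

Definition live (s : mts_state T) (rho : T -> T) : {set T} :=
  [set x in stU s :\: Z | rho x \in stU s :\: stL s].

(** Each selection costs [c] units of weight, taken from vertices that are no longer live; the
    weight of live vertices is kept for later selections. *)
Definition paid (s : mts_state T) : Prop :=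
  exists2 rho, rooted s rho &
    c * #|stS s| <= \sum_(x in ~: (live s rho :|: Z)) w x.

Definition leafy (W : {set T}) : Prop :=
  W != set0 -> exists2 x, x \in W & #|Gin e x :&: W| <= 1.

(* In case 3 every vertex of [U :\: L] satisfies 0 < k <= delta, so a leaf has
   the largest possible ratio 1/2, attained only for k = delta = 1. *)
Lemma case3_leaf s v : mts_inv e t s -> leafy (stU s :\: stL s) ->
  (forall u, ~~ mts_case1 s u) -> (forall u, ~~ mts_case2 s u) ->
  v \in stU s :\: stL s ->
  (forall u, u \in stU s :\: stL s -> (mts_ratio s u <= mts_ratio s v)%R) ->
  #|Gin e v :&: (stU s :\: stL s)| = 1.
Proof.
move=> I lf nc1 nc2 vUL vmax.
have bnd u : u \in stU s :\: stL s -> 0 < stk s u <= std s u.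
  move=> uUL; have := nc2 u; rewrite /mts_case2 uUL /= -leqNgt => ->.
  by have := nc1 u; rewrite /mts_case1 (setDP uUL).1 /= andbT lt0n.
have [|x xUL dx1] := lf; first by apply/set0Pn; exists v.
rewrite -(inv_d I) ?(setDP xUL).1 // in dx1.
have /andP[kx kdx] := bnd x xUL; have /andP[kv kdv] := bnd v vUL.
have dx : std s x = 1 by lia.
have := mts_ratio_le _ _ (vmax x xUL); rewrite -(inv_d I) ?(setDP vUL).1 // dx.
have -> : stk s x = 1 by lia.
(* Comparison with the leaf [x] gives [delta (delta + 1) <= 2 k <= 2 delta] at [v]. *)
by move=> /(_ isT (leq_trans kv kdv)); nia.
Qed.

Hypothesis pay : forall X : {set T}, [disjoint X & Z] -> blocking e t Z X ->
  c <= \sum_(x in X) w x.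

Lemma paid_step s s' : mts_inv e t s -> Z \subset stL s ->
  ((forall u, ~~ mts_case1 s u) -> (forall u, ~~ mts_case2 s u) ->
   leafy (stU s :\: stL s)) ->
  paid s -> mts_step e s s' -> paid s'.
Proof.
move=> I ZL lf [rho [r1 r2] cost].
case=> [v c1|v nc1 c2|v nc1 nc2 vUL vmax].
- exists rho; first split=> /=.
  + by move=> x xU; apply: r1; move: xU; rewrite !inE => /and3P[-> _ ->].
  + move=> x y; rewrite !inE => /and4P[xZ xL _ xU] /and3P[yZ _ yU].
    by apply: r2; rewrite !inE ?xZ ?xL ?xU ?yZ ?yU.
  + apply: leq_trans cost _; apply: sum_subset; rewrite setCS setSU //.
    by apply/subsetP => x; rewrite !inE => /and4P[/and3P[-> _ ->] -> _ ->].
- have /andP[vUL dk] := c2; have /setDP[vU vL] := vUL.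
  have vZ : v \notin Z by apply: contra vL; apply: (subsetP ZL).
  have rv := r1 v vUL.
  have kpos u : u \in stU s -> #|Gin e u :\: stU s| < t u.
    by move=> uU; have := nc1 u; rewrite /mts_case1 uU /= (inv_k I) // -lt0n subn_gt0.
  (* These vertices are live and cease to be so when [v] leaves [U], so their weight is still
     unspent. *)
  pose X := [set x in stU s :\: Z | rho x == v].
  have XU x : x \in X -> x \in stU s by rewrite !inE => /andP[/andP[]].
  have vX : v \in X by rewrite !inE rv eqxx vU vZ.
  have bX : blocking e t Z X.
    split; first by apply/set0Pn; exists v.
    move=> x xX; have xU := XU x xX; case: (eqVneq x v) => [xv|xv].
      (* The limbo neighbours of [v] in [U :\: Z] hang from [v] and lie in [X]; the neighbours left
         are outside [U] or counted by [delta < k]. *)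
      move: dk; rewrite xv (inv_k I) // (inv_d I) // => dk.
      suff : #|Gin e v :\: (Z :|: X)| <=
          #|Gin e v :\: stU s| + #|Gin e v :&: (stU s :\: stL s)| by lia.
      apply: leq_trans (leq_card_setU _ _); apply/subset_leq_card/subsetP => y.
      rewrite !inE => /andP[/norP[yZ yX] eyv]; move: yX; rewrite eyv yZ /= andbT.
      case: (boolP (y \in stU s)) => //= yU; case: (boolP (y \in stL s)) => //= yL.
      by rewrite (r2 y v) ?rv ?eqxx // !inE ?yZ ?yL ?yU ?vZ ?vU.
    (* A limbo vertex shares its root with all its neighbours in [U :\: Z], so the neighbours not in
       [Z :|: X] are outside [U], and the failure of case 1 bounds their number. *)
    apply: leq_ltn_trans (kpos x xU); apply/subset_leq_card/subsetP => y.
    rewrite !inE => /andP[/norP[yZ yX] eyx]; rewrite eyx andbT.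
    apply: contra yX => yU; rewrite yU yZ /=.
    move: xX; rewrite !inE => /andP[/andP[xZ _] /eqP rx]; rewrite -rx eq_sym.
    have xL : x \in stL s.
      by apply: contraNT xv => xL; rewrite -rx r1 // !inE xL xU.
    by apply/eqP/r2; rewrite ?inE ?xZ ?xL ?xU ?yZ ?yU // e_sym.
  exists rho; first split=> /=.
  + by move=> x xU; apply: r1; move: xU; rewrite !inE => /and3P[-> _ ->].
  + move=> x y; rewrite !inE => /and4P[xZ xL _ xU] /and3P[yZ _ yU].
    by apply: r2; rewrite !inE ?xZ ?xL ?xU ?yZ ?yU.
  + have XZ : [disjoint X & Z].
      by rewrite disjoint_subset; apply/subsetP => x; rewrite !inE => /andP[/andP[]].
    have vS : v \notin stS s by apply: contraL vU => /(inv_SU I).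
    rewrite cardsU1 vS add1n mulnS; apply: leq_trans (leq_add (pay XZ bX) cost) _.
    rewrite [X in _ <= X](big_setID X) /=; apply: leq_add; apply: sum_subset.
      apply/subsetP => x xX; have := xX; rewrite !inE => /andP[/andP[xZ xU] /eqP rx].
      by rewrite (negPf xZ) xU rx eqxx !andbF.
    apply/subsetP => x; rewrite !inE /=.
    case: (eqVneq (rho x) v) => [->|_]; rewrite ?vU ?vL /=; case: (x \in Z);
      case: (x \in stU s); case: (x == v); rewrite ?andbF ?orbF //=.
- have /eqP/cards1P[u Nv] := case3_leaf I (lf nc1 nc2) nc1 nc2 vUL vmax.
  have /setDP[vU vL] := vUL; have rv := r1 v vUL.
  have : u \in Gin e v :&: (stU s :\: stL s) by rewrite Nv set11.
  rewrite in_setI => /andP[euv uUL].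
  have uv : u != v by apply: contraTneq euv => ->; rewrite inE e_irr.
  have ru := r1 u uUL.
  (* Everything that hung from [v] is rehung from [u], the only neighbour of [v] in [U :\: L]. *)
  exists (fun x => if rho x == v then u else rho x); first split=> /=.
  + move=> x; rewrite !inE negb_or => /andP[/andP[xv xL] xU].
    by rewrite r1 ?inE ?xL ?xU // (negPf xv).
  + move=> x y; rewrite !inE /= => /and3P[xZ xvL xU] /andP[yZ yU] exy.
    case: (boolP (x \in stL s)) => xL.
      by rewrite (r2 x y) // !inE ?xZ ?xL ?xU ?yZ ?yU.
    have xv : x = v by move: xvL; rewrite (negPf xL) orbF => /eqP.
    subst x; case: (boolP (y \in stL s)) => yL.
      by rewrite (r2 y v) // ?inE ?yZ ?yL ?yU ?xZ ?vU // e_sym.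
    have : y \in Gin e v :&: (stU s :\: stL s).
      by rewrite !inE yL yU e_sym exy.
    by rewrite Nv inE => /eqP->; rewrite rv ru eqxx (negPf uv).
  + apply: leq_trans cost _; apply: sum_subset; rewrite setCS setSU //.
    apply/subsetP => x; rewrite !inE => /andP[->] /=.
    by case: (eqVneq (rho x) v) => [->|_]; rewrite ?vL ?vU // negb_or => /andP[/andP[_ ->]].
Qed.

End Rooted.

Lemma sum_mem_card (T : finType) (A B : {set T}) :
  \sum_(x in A) (x \in B) = #|A :&: B|.
Proof.
by rewrite -big_mkcondr sum1_card; apply: eq_card => x; rewrite !inE.
Qed.

Lemma mts_step_mono (T : finType) (e : rel T) (s s' : mts_state T) :
  mts_step e s s' -> (stU s' \subset stU s) && (stL s \subset stL s').
Proof. by case=> *; rewrite /= ?subD1set ?subsetUr subxx. Qed.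

Lemma paid_start (T : finType) (e : rel T) (Z : {set T}) w c (s : mts_state T) :
  stS s = set0 -> stL s \subset Z -> paid e Z w c s.
Proof.
move=> S0 LZ; exists id; last by rewrite S0 cards0 muln0.
split=> // x y /setDP[/setIP[/(subsetP LZ) xZ _]]; by rewrite xZ.
Qed.

Lemma target_set_pay (T : finType) (e : rel T) (t : T -> nat) (S X : {set T}) :
  target_set e t S -> blocking e t set0 X -> 0 < \sum_(x in X) (x \in S).
Proof.
by move=> tS /(target_set_hits tS); rewrite sum_mem_card card_gt0 setIC.
Qed.

Lemma paid_leq_card (T : finType) (e : rel T) (S : {set T}) (s : mts_state T) :
  paid e set0 (fun x => x \in S : nat) 1 s -> #|stS s| <= #|S|.
Proof.
move=> [rho _]; rewrite mul1n sum_mem_card => /leq_trans; apply.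
exact/subset_leq_card/subsetIr.
Qed.

(** * Trees: unit charges against the elements of a target set *)

Section Tree.

Variables (T : finType) (e : rel T) (t : T -> nat).
Hypotheses (e_sym : symmetric e) (e_irr : irreflexive e).
Hypothesis acyclic : forall c : seq T, ucycle e c -> size c < 3.

(** If all degrees inside [W] were at least 2, a path could be prolonged forever, since meeting
    itself would close a cycle. *)
Lemma acyclic_leafy (W : {set T}) : leafy e W.
Proof.
move=> W0.
case: (boolP [exists x in W, #|Gin e x :&: W| <= 1]) => [/exists_inP //|].
rewrite negb_exists_in => /forall_inP deg2; exfalso.
have long n : exists x p, [/\ uniq (x :: p), path e x p, x \in W & size p = n].
  elim: n => [|n [x [p [up pp xW sp]]]].
    by have /set0Pn[x xW] := W0; exists x, [::].
  (* The path grows at its front; [head x p] is the neighbour of [x] already on it. The default [x]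
     excludes nothing, as [x] is not its own neighbour. *)
  have : 0 < #|(Gin e x :&: W) :\ head x p|.
    by have := deg2 x xW; rewrite (cardsD1 (head x p)); case: (_ \in _); lia.
  rewrite card_gt0 => /set0Pn[y]; rewrite !inE => /and3P[yh eyx yW].
  exists y, (x :: p); split; rewrite ?[size _]/= ?sp //; last by rewrite /= eyx pp.
  rewrite cons_uniq up andbT inE negb_or; apply/andP; split.
    by apply: contraTneq eyx => ->; rewrite e_irr.
  apply/negP => yp; case/splitPr: yp yh up pp => p1 p2 yh up pp.
  have : ucycle e (x :: rcons p1 y).
    rewrite /ucycle /= rcons_path last_rcons eyx andbT.
    move: pp up; rewrite -cat_rcons cat_path -cat_cons cat_uniq.
    by move=> /andP[-> _] /and3P[/= -> _ _].
  (* A closed walk of size below 3 forces [p1] to be empty, and then [y] is the excluded head. *)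
  move/acyclic; rewrite /= size_rcons; case: p1 yh {up pp} => //=.
  by rewrite eqxx.
have [x [p [up _ _ sp]]] := long #|T|.
by have := max_card (mem (x :: p)); rewrite (card_uniqP up) /= sp ltnn.
Qed.

Lemma tree_bound s S' : mts_reachable e t s -> target_set e t S' ->
  #|stS s| <= #|S'|.
Proof.
move=> rs tS'; apply: (@paid_leq_card _ e).
elim: rs => [|s1 s2 r1 IH st]; first by apply: paid_start; rewrite //= sub0set.
apply: (paid_step e_sym e_irr _ (mts_reachable_inv e_irr r1) _ _ IH st).
- by move=> X _; apply: target_set_pay.
- exact: sub0set.
- by move=> _ _; apply: acyclic_leafy.
Qed.

End Tree.

(** * Cycles: counting boundary edges *)

Section Cycle.

Variables (T : finType) (e : rel T) (t : T -> nat).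
Hypotheses (e_sym : symmetric e) (e_irr : irreflexive e).
Variable c : seq T.
Hypotheses (c_size : 3 <= size c) (c_uniq : uniq c) (c_all : forall x : T, x \in c).
Hypothesis c_edge : forall x y, e x y = (y == next c x) || (x == next c y).

Lemma next_closed_setT (W : {set T}) :
  W != set0 -> (forall x, x \in W -> next c x \in W) -> W = setT.
Proof.
move=> /set0Pn[x xW] H; apply/setP => y; rewrite inE.
have : fconnect (next c) x y.
  by rewrite (fconnect_cycle (cycle_next c_uniq) (c_all x)).
move=> /iter_findex <-; elim: (findex _ _ _) => //= n; exact: H.
Qed.

Lemma next_exit (W : {set T}) : W != set0 -> W != setT ->
  exists2 x, x \in W & next c x \notin W.
Proof.
move=> W0 WT.
case: (boolP [exists x in W, next c x \notin W]) => [/exists_inP //|].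
rewrite negb_exists_in => /forall_inP H; case/eqP: WT; apply: next_closed_setT => //.
by move=> x /H; rewrite negbK.
Qed.

Lemma cycle_Gin x : Gin e x = [set next c x; prev c x].
Proof.
apply/setP => y; rewrite !inE c_edge orbC; congr (_ || _).
by apply/eqP/eqP => ->; rewrite ?next_prev ?prev_next.
Qed.

(** Otherwise [x] and its successor would be closed under [next c], leaving at most two vertices. *)
Lemma next_neq_prev x : next c x != prev c x.
Proof.
apply/eqP => np.
have : [set x; next c x] = setT.
  apply: next_closed_setT; first by apply/set0Pn; exists x; rewrite !inE eqxx.
  move=> y; rewrite !inE => /orP[]/eqP->; rewrite ?eqxx ?orbT //.
  by rewrite np next_prev // eqxx.
move/(congr1 (fun A : {set T} => #|A|)); rewrite cardsT cards2 => cT.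
have := max_card (mem c); rewrite (card_uniqP c_uniq).
by move: c_size; case: (_ != _) cT => /= <-; lia.
Qed.

Lemma card_cycle_Gin x : #|Gin e x| = 2.
Proof. by rewrite cycle_Gin cards2 next_neq_prev. Qed.

(** A vertex whose successor leaves [W] has at most its predecessor as neighbour in [W]. *)
Lemma cycle_leafy (W : {set T}) : W != setT -> leafy e W.
Proof.
move=> WT W0; have [x xW nx] := next_exit W0 WT; exists x => //.
rewrite -(cards1 (prev c x)); apply/subset_leq_card/subsetP => y.
rewrite cycle_Gin !inE => /andP[/orP[/eqP->|//]].
by rewrite (negPf nx).
Qed.

(** Going round the cycle, one edge leaves [X] at [x] and one enters it at [next c z]. If these two
    vertices coincide, both edges at that vertex count, and they have distinct ends. *)
Lemma cycle_boundary (X : {set T}) : X != set0 -> X != setT ->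
  2 <= \sum_(x in X) #|Gin e x :\: X|.
Proof.
move=> X0 XT; have [x xX nx] := next_exit X0 XT.
have [||z] := @next_exit (~: X).
- by rewrite -setCT (inj_eq (@setC_inj T)).
- by rewrite -setC0 (inj_eq (@setC_inj T)).
rewrite !inE negbK => zX nz.
have zE : z \in Gin e (next c z) :\: X.
  by rewrite inE zX cycle_Gin !inE prev_next // eqxx orbT.
have xE : next c x \in Gin e x :\: X by rewrite inE nx cycle_Gin !inE eqxx.
rewrite (bigD1 x) //=; case: (eqVneq (next c z) x) => [zx|zx].
  apply: leq_trans (leq_addr _ _); rewrite (cardsD1 (next c x)) xE ltnS card_gt0.
  apply/set0Pn; exists z; rewrite in_setD1 -{2}zx zE andbT -zx.
  by have := next_neq_prev (next c z); rewrite prev_next // eq_sym.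
rewrite (bigD1 (next c z)) ?nz ?zx //= addnA.
apply: leq_trans (leq_addr _ _).
have : 0 < #|Gin e x :\: X| by rewrite card_gt0; apply/set0Pn; exists (next c x).
have : 0 < #|Gin e (next c z) :\: X| by rewrite card_gt0; apply/set0Pn; exists z.
by lia.
Qed.

(* The boundary of the inactive set drops by at least 2 (t y - 1) when y, of
   degree 2, becomes active. *)
Lemma cycle_inactive_bound (S Y : {set T}) : target_set e t S ->
  [disjoint S & Y] ->
  2 * (\sum_(x in Y) t x) <= 2 * #|Y| + \sum_(x in Y) #|Gin e x :\: Y|.
Proof.
move=> tS; move: {2}#|Y| (leqnn #|Y|) => n.
elim: n Y => [|n IH] Y; first by rewrite leqn0 cards_eq0 => /eqP->; rewrite !big_set0.
case: (eqVneq Y set0) => [->|Y0 sz SY]; first by rewrite !big_set0.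
have [|y yY ty] := @not_blocking _ e t Y Y0.
  by move=> /(target_set_hits tS); rewrite setI_eq0 SY.
have cY := cardsD1 y Y; rewrite yY in cY.
have := IH (Y :\ y); rewrite cY add1n ltnS in sz => /(_ sz).
have -> : [disjoint S & Y :\ y].
  by rewrite disjoint_sym; apply: disjointWl (subD1set _ _) _; rewrite disjoint_sym.
move=> /(_ isT) {}IH; rewrite !(big_setD1 y yY) /= cY.
(* Taking [y] out of [Y] turns each edge from [y] into [Y] into a boundary edge. *)
have E : \sum_(x in Y :\ y) #|Gin e x :\: (Y :\ y)| =
    \sum_(x in Y :\ y) #|Gin e x :\: Y| + #|Gin e y :&: Y|.
  rewrite (eq_bigr (fun x => #|Gin e x :\: Y| + (x \in Gin e y))); last first.
    by move=> x _; rewrite cardsDD1 // !inE e_sym.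
  rewrite big_split /= sum_mem_card; congr (_ + _); apply: eq_card => x.
  rewrite !inE andbC; case: (eqVneq x y) => [->|//]; by rewrite e_irr.
have := cardsID Y (Gin e y); rewrite card_cycle_Gin.
by move: IH ty; rewrite E; lia.
Qed.

(** At most [2 * #|S|] edges join [S] to its complement, so the [(t x).-1] outside [S] sum to at
    most [#|S|]; those inside [S] are at most 1 each. *)
Lemma cycle_target_bound (S : {set T}) : target_set e t S ->
  (forall u, 0 < t u <= 2) -> \sum_x (t x).-1 <= 2 * #|S|.
Proof.
move=> tS t12.
have := @cycle_inactive_bound S (~: S) tS; rewrite disjoints_subset setCK subxx => /(_ isT).
have -> : \sum_(x in ~: S) #|Gin e x :\: ~: S| = \sum_(y in S) #|~: S :&: Gin e y|.
  under eq_bigr => x _ do rewrite setDE setCK setIC -sum_mem_card.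
  rewrite exchange_big /=; apply: eq_bigr => y _; rewrite -sum_mem_card.
  by apply: eq_bigr => x _; rewrite !inE e_sym.
have le2 : \sum_(y in S) #|~: S :&: Gin e y| <= 2 * #|S|.
  rewrite mulnC -sum_nat_const; apply: leq_sum => y _; rewrite -(card_cycle_Gin y).
  exact/subset_leq_card/subsetIr.
have tE (A : {set T}) : \sum_(x in A) t x = \sum_(x in A) (t x).-1 + #|A|.
  rewrite -sum1_card -big_split; apply: eq_bigr => x _ /=.
  by have /andP[/prednK <- _] := t12 x; rewrite addn1.
have le1 : \sum_(x in S) (t x).-1 <= #|S|.
  by rewrite -sum1_card; apply: leq_sum => x _; have := t12 x; lia.
rewrite tE => H; rewrite (bigID (mem S)) /=.
have -> : \sum_(x | x \notin S) (t x).-1 = \sum_(x in ~: S) (t x).-1.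
  by apply: eq_bigl => x; rewrite inE.
by lia.
Qed.

(** In a set blocking relative to [[set v0]], a vertex has at most [(t x).-1] boundary edges not
    going to [v0], and [e v0 x] adds the edge to [v0]. The weight thus bounds its boundary
    degree. *)
Definition first_limbo_weight (v0 x : T) : nat := (t x).-1 + e v0 x.

Lemma first_limbo_pay v0 (X : {set T}) : [disjoint X & [set v0]] ->
  blocking e t [set v0] X -> 2 <= \sum_(x in X) first_limbo_weight v0 x.
Proof.
move=> dX [X0 bX]; have XT : X != setT.
  by apply: contraTneq dX => ->; rewrite -setI_eq0 setTI; apply/set0Pn; exists v0; rewrite inE.
apply: leq_trans (cycle_boundary X0 XT) _; apply: leq_sum => x xX.
have := bX x xX; rewrite /first_limbo_weight (cardsD1 v0 (Gin e x :\: X)) in_setD.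
have -> : (Gin e x :\: X) :\ v0 = Gin e x :\: ([set v0] :|: X) by rewrite setDDl setUC.
by rewrite inE; case: (v0 \notin X); case: (e v0 x); lia.
Qed.

Lemma first_limbo_bound v0 s S' : target_set e t S' ->
  (forall u, 0 < t u <= 2) -> (forall u, t u <= t v0) ->
  paid e [set v0] (first_limbo_weight v0) 2 s -> #|stS s| <= #|S'|.
Proof.
move=> tS' t12 tmax [rho _ cost].
have lb := cycle_target_bound tS' t12.
have S'0 : 0 < #|S'|.
  have bT : blocking e t set0 setT.
    split; first by apply/set0Pn; exists v0; rewrite inE.
    by move=> x _; rewrite setUT setDT cards0; case/andP: (t12 x).
  by have := target_set_hits tS' bT; rewrite setIT card_gt0.
have ub : 2 * #|stS s| <= \sum_(x in [set~ v0]) (t x).-1 + 2.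
  apply: leq_trans cost _.
  apply: leq_trans (_ : _ <= \sum_(x in [set~ v0]) first_limbo_weight v0 x) _.
    by apply: sum_subset; rewrite setCS subsetUr.
  rewrite big_split leq_add2l /= -(card_cycle_Gin v0).
  rewrite (eq_bigr (fun x => (x \in Gin e v0) : nat)); last by move=> x _; rewrite inE e_sym.
  by rewrite sum_mem_card; apply/subset_leq_card/subsetIr.
move: lb; rewrite (bigD1 v0) //=.
have -> : \sum_(x | x != v0) (t x).-1 = \sum_(x in [set~ v0]) (t x).-1.
  by apply: eq_bigl => x; rewrite !inE.
(* If [t v0 = 2], the term of [v0] in the lower bound leaves [2 * #|stS s| <= 2 * #|S'| + 1], and
   parity concludes. If [t v0 = 1], all thresholds are 1 and [#|stS s| <= 1]. *)
case: (leqP (t v0) 1) => [t1|t2]; last by lia.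
move: ub; rewrite big1 => [|x _]; first by lia.
by have := tmax x; lia.
Qed.

Lemma cycle_bound s S' : mts_reachable e t s -> target_set e t S' ->
  #|stS s| <= #|S'|.
Proof.
move=> rs tS'.
(* Either the first step removes a vertex, and what remains is always a forest, or it puts some [v0]
   in limbo, and the charging starts afresh with [v0] ignored. *)
suff : (paid e set0 (fun x => x \in S' : nat) 1 s /\
          (s = mts_init e t \/ stU s != setT)) \/
       exists2 v0, [/\ v0 \in stL s, forall u, 0 < t u <= 2 & forall u, t u <= t v0]
         & paid e [set v0] (first_limbo_weight v0) 2 s.
  by case=> [[/paid_leq_card//]|[v0 [_ t12 tmax]]]; apply: first_limbo_bound.
elim: rs => [|s1 s2 r1 IH st].
  by left; split; [apply: paid_start; rewrite //= sub0set | left].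
have I := mts_reachable_inv e_irr r1; have /andP[UU LL] := mts_step_mono st.
have payS (X : {set T}) : [disjoint X & set0] -> blocking e t set0 X ->
    1 <= \sum_(x in X) (x \in S') by move=> _; apply: target_set_pay.
case: IH => [[pd [E|UT]]|[v0 [v0L t12 tmax] pd]].
- subst s1; case: st pd {UU LL} => [v c1|v nc1 c2|v nc1 nc2 vUL vmax] pd.
  + left; split; last by right; apply/eqP => /setP/(_ v); rewrite !inE eqxx.
    apply: (paid_step e_sym e_irr payS I _ _ pd (MtsStep1 e c1)); rewrite ?sub0set //.
    by move=> /(_ v); rewrite c1.
  + left; split; last by right; apply/eqP => /setP/(_ v); rewrite !inE eqxx.
    apply: (paid_step e_sym e_irr payS I _ _ pd (MtsStep2 e nc1 c2)); rewrite ?sub0set //.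
    by move=> _ /(_ v); rewrite c2.
  + right; exists v; last by apply: paid_start; rewrite //= setU0 subxx.
    have tpos u : 0 < t u.
      by have := nc1 u; rewrite /mts_case1 /= inE lt0n.
    have t2 u : t u <= 2.
      by have := nc2 u; rewrite /mts_case2 /= !inE /= card_cycle_Gin -leqNgt.
    split; first by rewrite !inE eqxx.
      by move=> u; rewrite tpos t2.
    (* Initially every [delta] is 2, so the largest ratio means the largest threshold. *)
    move=> u; have uUL : u \in stU (mts_init e t) :\: stL (mts_init e t) by rewrite !inE.
    by have := mts_ratio_le _ _ (vmax u uUL); rewrite /= !card_cycle_Gin => /(_ isT isT); lia.
- left; split; last by right; apply: contraNneq UT => E; rewrite E subTset in UU.
  apply: (paid_step e_sym e_irr payS I _ _ pd st); rewrite ?sub0set //.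
  move=> _ _; apply: cycle_leafy; apply: contraNneq UT => E.
  by rewrite -subTset -E; apply: subsetDl.
- right; exists v0; first by split=> //; apply: (subsetP LL).
  apply: (paid_step e_sym e_irr (@first_limbo_pay v0) I _ _ pd st).
    by rewrite sub1set.
  move=> _ _; apply: cycle_leafy; apply/eqP => /setP/(_ v0); by rewrite !inE v0L.
Qed.

End Cycle.

(** * Cliques: blocking sets of large thresholds *)

Section Clique.

Variables (T : finType) (e : rel T) (t : T -> nat).
Hypotheses (e_irr : irreflexive e) (e_clique : is_clique e).

Lemma clique_Gin x : Gin e x = [set~ x].
Proof.
apply/setP => y; rewrite !inE; case: (eqVneq y x) => [->|/e_clique//].
by rewrite e_irr.
Qed.

Lemma card_clique_GinD x (A : {set T}) : x \in A -> #|Gin e x :\: A| = #|~: A|.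
Proof.
move=> xA; apply: eq_card => y; rewrite clique_Gin !inE.
by case: (eqVneq y x) => [->|]; rewrite ?xA ?andbT.
Qed.

(* Limbo consists of vertices of largest threshold, so once one of them gets
   activated no vertex outside limbo needs to be selected any more. *)
Definition clique_inv (s : mts_state T) : Prop :=
  [/\ stL s \subset stU s,
      forall x, x \in stS s -> #|~: stL s| <= t x
    & forall x u, x \in stL s -> u \in stU s :\: stL s -> t u <= t x] \/
  (forall u, u \in stU s :\: stL s -> t u <= #|~: stU s|).

Lemma clique_k s u : mts_inv e t s -> u \in stU s -> stk s u = t u - #|~: stU s|.
Proof. by move=> I uU; rewrite (inv_k I) // card_clique_GinD. Qed.

Lemma clique_d s u : mts_inv e t s -> u \in stU s :\: stL s ->
  std s u = #|stU s :\: stL s|.-1.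
Proof.
move=> I uUL; rewrite (inv_d I) ?(setDP uUL).1 // [in RHS](cardsD1 u) uUL /=.
by apply: eq_card => y; rewrite clique_Gin !inE.
Qed.

(** Here [delta < k] reads [#|U :\: L| - 1 < t v - #|~: U|], and [L] lies within [U]. *)
Lemma clique_case2 s v : mts_inv e t s -> stL s \subset stU s -> mts_case2 s v ->
  #|~: stL s| <= t v.
Proof.
move=> I LU /andP[vUL]; rewrite (clique_d I) // (clique_k I) ?(setDP vUL).1 //.
have := cardsC (stL s); have := cardsC (stU s); have := cardsD (stU s) (stL s).
rewrite (setIidPr LU); have := subset_leq_card LU; have := max_card (stU s).
have : 0 < #|stU s :\: stL s| by rewrite card_gt0; apply/set0Pn; exists v.
by lia.
Qed.

Lemma clique_inv_step s s' : mts_inv e t s -> clique_inv s -> mts_step e s s' ->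
  clique_inv s'.
Proof.
move=> I cI; have kE u := @clique_k s u I; have dE u := @clique_d s u I.
case=> [v c1|v nc1 c2|v nc1 nc2 vUL vmax].
- have /andP[vU /eqP] := c1; rewrite kE // => /eqP; rewrite subn_eq0 => tv.
  case: cI => [[LU tS tL]|tU]; last first.
    right=> u /=; rewrite in_setD => /andP[uL /setD1P[_ uU]].
    apply: leq_trans (tU u _) _; first by rewrite inE uL uU.
    by apply/subset_leq_card; rewrite setCS subD1set.
  (* For [v] in limbo, [t u <= t v <= #|~: stU s|] for every [u] in [U :\: L], so all these have
     [k = 0] from then on and cases 2 and 3 cannot occur. *)
  case: (boolP (v \in stL s)) => vL; [right|left]; rewrite /=.
    move=> u; rewrite in_setD => /andP[uL /setD1P[_ uU]].
    apply: leq_trans (tL v u vL _) _; first by rewrite inE uL uU.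
    by apply: leq_trans tv _; apply/subset_leq_card; rewrite setCS subD1set.
  split=> //; first by rewrite subsetD1 LU.
  by move=> x u xL; rewrite in_setD => /andP[uL /setD1P[_ uU]]; apply: tL; rewrite // inE uL.
- have /andP[vUL] := c2; have /setDP[vU vL] := vUL; rewrite kE // dE // => dk.
  case: cI => [[LU tS tL]|tU]; last by have := tU v vUL; lia.
  left; split=> /=; first by rewrite subsetD1 LU.
    move=> x; rewrite !inE => /orP[/eqP->|]; last exact: tS.
    exact: clique_case2 c2.
  move=> x u xL; rewrite in_setD => /andP[uL /setD1P[_ uU]]; apply: tL; by rewrite // inE uL.
- have kpos u : u \in stU s -> #|~: stU s| < t u.
    by move=> uU; have := nc1 u; rewrite /mts_case1 uU kE //= -lt0n subn_gt0.
  have /setDP[vU vL] := vUL.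
  case: cI => [[LU tS tL]|tU]; last by have := tU v vUL; have := kpos v vU; lia.
  left; split=> /=; first by rewrite subUset sub1set vU.
    by move=> x /tS; apply: leq_trans; rewrite subset_leq_card // setCS subsetUr.
  move=> x u /setU1P[->|xL]; rewrite in_setD => /andP[]; rewrite !inE negb_or.
    move=> /andP[uv uL] uU; have uUL : u \in stU s :\: stL s by rewrite inE uL.
    have := mts_ratio_le _ _ (vmax u uUL).
    have := nc2 u; rewrite /mts_case2 uUL /= -leqNgt; have := kpos u uU.
    have := kpos v vU; rewrite !dE // !kE // => kv ku kd.
    have d0 : 0 < #|stU s :\: stL s|.-1 by lia.
    (* All [delta] on [U :\: L] agree in a clique, so the largest ratio means the largest
       threshold. *)
    move=> /(_ d0 d0); rewrite leq_pmul2r ?muln_gt0 ?d0 //; lia.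
  by move=> /andP[uv uL] uU; apply: tL; rewrite // inE uL.
Qed.

Lemma clique_bound s S' : mts_reachable e t s -> target_set e t S' ->
  #|stS s| <= #|S'|.
Proof.
move=> rs tS'; suff [] : clique_inv s /\ #|stS s| <= #|S'| by [].
elim: rs => [|s1 s2 r1 [cI IH] st].
  split; last by rewrite cards0.
  by left; split=> [|x|x u] /=; rewrite ?sub0set ?inE.
have I := mts_reachable_inv e_irr r1.
split; first exact: clique_inv_step st.
case: st => [//|v nc1 c2|//] /=.
have /andP[vUL] := c2; have /setDP[vU vL] := vUL; rewrite (clique_k I) // => dk.
case: cI => [[LU tS tL]|tU]; last by have := tU v vUL; lia.
have tv := clique_case2 I LU c2.
have vS : v \notin stS s1 by apply: contraL vU => /(inv_SU I).
pose X := (v |: stS s1) :|: stL s1.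
have cX : #|X| = #|v |: stS s1| + #|stL s1|.
  rewrite -cardsUI -[LHS]addn0; congr (_ + _); apply/eqP; rewrite eq_sym cards_eq0 -subset0.
  apply/subsetP => x; rewrite !inE => /andP[/orP[/eqP->|/(inv_SU I)/negP xU]].
    by rewrite (negPf vL).
  by move=> /(subsetP LU)/xU.
have tX x : x \in X -> #|~: stL s1| <= t x.
  rewrite !inE -orbA => /or3P[/eqP->//|/tS//|xL]; exact: leq_trans tv (tL _ _ xL vUL).
(* Hence [S'] contains at least [#|X| - #|stL s1|] vertices of [X], which is the number selected
   once [v] is added. *)
have : #|X :\: S'| <= #|stL s1|.
  rewrite leqNgt; apply/negP => big.
  have : blocking e t set0 (X :\: S').
    split; first by rewrite -card_gt0; lia.
    move=> x xX; rewrite set0U card_clique_GinD //; apply: leq_trans (tX x _).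
      by have := cardsC (X :\: S'); have := cardsC (stL s1); lia.
    by have /setDP[] := xX.
  move/(target_set_hits tS') => /set0Pn[x]; rewrite !inE => /andP[->]; by [].
have := cardsID S' X; have := subset_leq_card (subsetIr X S'); lia.
Qed.

End Clique.

(** * Termination, progress and optimality for the three classes of graphs *)

Theorem theorem2 (T : finType) (e : rel T) (t : T -> nat)
    (e_sym : symmetric e) (e_irr : irreflexive e)
    (he : is_tree e \/ is_cycle e \/ is_clique e) :
  mts_always_returns e t (min_target_set e t).
Proof.
split=> [f _|s /(mts_reachable_inv e_irr)|s rs U0]; first exact: mts_terminates.
  exact: mts_progress.
split; first exact: mts_target (mts_reachable_inv e_irr rs) U0.
move=> S' tS'; case: he => [[_ _ ac]|[[c [c3 cu ca ce]]|cl]].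
- exact: tree_bound rs tS'.
- exact: (cycle_bound e_sym e_irr c3 cu ca ce rs tS').
- exact: clique_bound rs tS'.
Qed.
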